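(* Let $f,g:\mathbb{R}^n\to\mathbb{R}\cup\{+\infty\}$ be closed convex proper functions and let $h:\mathbb{R}^n\to\mathbb{R}$ be convex and $L$-smooth with $L>0$, such that there exist $x^\star,u^\star\in\mathbb{R}^n$ with $0\in\partial f(x^\star)+\nabla h(x^\star)+u^\star$ and $0\in\partial g^*(u^\star)-x^\star$. Let $\alpha=\frac1L$, let $x^0,u^0\in\mathbb{R}^n$, and let $\{(x^k,u^k)\}_{k\ge 0}$ be generated by $$x^{k+1}=\mathrm{prox}_{\alpha f}\big(x^k-\alpha(u^k+\nabla h(x^k))\big),\qquad u^{k+1}=\mathrm{prox}_{\alpha^{-1}g^*}\Big(u^k+\tfrac1\alpha\big(2x^{k+1}-x^k+\alpha\nabla h(x^k)-\alpha\nabla h(x^{k+1})\big)\Big),\qquad k=0,1,2,\dots$$ For $k\ge1$ let $p^k=x^k+(x^k-x^{k-1})+\alpha\big((\nabla h(x^{k-1})+u^{k-1})-(\nabla h(x^k)+u^k)\big)\in\partial g^*(u^k)$, let $\widetilde\nabla f(x^k)=\frac1\alpha\big(x^{k-1}-\alpha(u^{k-1}+\nabla h(x^{k-1}))-x^k\big)\in\partial f(x^k)$, and $v^k=\widetilde\nabla f(x^k)+u^k+\nabla h(x^k)$. Let $K\ge1$ be an integer, $\bar x^K=\frac1K\sum_{k=1}^K x^k$, $\bar u^K=\frac1K\sum_{k=1}^K u^k$. Then for all $x,u\in\mathbb{R}^n$ and all subgradients $\bar p^K\in\partial g^*(\bar u^K)$, $p\in\partial g^*(u)$, $\widetilde\nabla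 f(\bar x^K)\in\partial f(\bar x^K)$, $$\mathcal{L}(\bar x^K,u)-\mathcal{L}(x,\bar u^K)-\frac{1}{\alpha(K+1)}\left(\|x^0-x\|^2+\alpha^2\|u^0-u\|^2\right)=I_f+I_g+I_h-\mathcal{S}_1-\mathcal{S}_2-\mathcal{S}_h,$$ where $$I_f=\tfrac1K\sum_{k=1}^K\big(f(\bar x^K)-f(x^k)+\langle\widetilde\nabla f(\bar x^K),x^k-\bar x^K\rangle\big)+\tfrac1K\sum_{k=1}^K\big(f(x^k)-f(x)+\langle\widetilde\nabla f(x^k),x-x^k\rangle\big),$$ $$I_g=\tfrac1K\sum_{k=1}^K\big(g(p^k)-g(\bar p^K)+\langle u^k,\bar p^K-p^k\rangle\big)+\tfrac1K\sum_{k=1}^K\big(g(p)-g(p^k)+\langle u,p^k-p\rangle\big),$$ $$\begin{aligned}I_h={}&\tfrac1K\sum_{k=1}^K\Big(h(\bar x^K)-h(x^k)+\langle\nabla h(\bar x^K),x^k-\bar x^K\rangle+\tfrac\alpha2\|\nabla h(x^k)-\nabla h(\bar x^K)\|^2\Big)\\&+\tfrac{K-1}{K(K+1)}\sum_{k=1}^K\Big(h(x^k)-h(x)+\langle\nabla h(x^k),x-x^k\rangle+\tfrac\alpha2\|\nabla h(x^k)-\nabla h(x)\|^2\Big)\\&+\tfrac{2}{K+1}\Big(h(x^0)-h(x)+\langle\nabla h(x^0),x-x^0\rangle+\tfrac\alpha2\|\nabla h(x^0)-\nabla h(x)\|^2\Big)\\&+\tfrac{2}{K(K+1)}\sum_{k=1}^K\Big(h(x^k)-h(x^0)+\langle\nabla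 h(x^k),x^0-x^k\rangle+\tfrac\alpha2\|\nabla h(x^k)-\nabla h(x^0)\|^2\Big),\end{aligned}$$ $$\mathcal{S}_h=\tfrac\alpha2\Big\|\nabla h(\bar x^K)-\tfrac1K\sum_{k=1}^K\nabla h(x^k)\Big\|^2+\tfrac{\alpha(K-1)}{2(K+1)}\Big\|\nabla h(x)-\tfrac1K\sum_{k=1}^K\nabla h(x^k)\Big\|^2,$$ $$\begin{aligned}\mathcal{S}_1=\tfrac{1}{K+1}\Big(&\tfrac1\alpha\Big\|x^0-x-\tfrac{\alpha(K+1)}{2K}\sum_{k=1}^K v^k-\alpha\Big(\nabla h(x^0)-\tfrac1K\sum_{k=1}^K\nabla h(x^k)\Big)\Big\|^2\\&+\alpha\Big\|u^0-u+\tfrac{K+1}{2K}\sum_{k=1}^K\big(\widetilde\nabla f(x^k)+u^k+\nabla h(x^k)\big)\Big\|^2+\alpha\|\nabla h(x^0)-\nabla h(x)\|^2\Big),\end{aligned}$$ $$\mathcal{S}_2=\tfrac{\alpha}{2K^2}\sum_{k=1}^K\sum_{l=1}^{k-1}\Big(\|v^k-\nabla h(x^k)-(v^l-\nabla h(x^l))\|^2+\|\nabla h(x^k)-\nabla h(x^l)\|^2\Big).$$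
   Context: $\langle\cdot,\cdot\rangle$ and $\|\cdot\|$ are the standard inner product and Euclidean norm on $\mathbb{R}^n$. $h$ is $L$-smooth if it is differentiable with $L$-Lipschitz gradient. $g^*(y)=\sup_x\{\langle y,x\rangle-g(x)\}$ is the Fenchel conjugate, $\partial$ the convex subdifferential, and $\mathrm{prox}_\varphi(x)=\arg\min_{y}\{\varphi(y)+\frac12\|y-x\|^2\}$. The Lagrangian is $\mathcal{L}(x,u)=f(x)+h(x)+\langle u,x\rangle-g^*(u)$, with $\mathcal{L}(x,u)=+\infty$ if $x\notin\mathrm{dom}\, f$ and $\mathcal{L}(x,u)=-\infty$ if $x\in\mathrm{dom}\, f$, $u\notin\mathrm{dom}\, g^*$; if $x\notin\mathrm{dom}\, f$ both sides of the equality are read as $-\infty$. The iteration is the swapped Davis--Yin splitting algorithm (variant DYS-$fg$) for minimizing $f+g+h$. *)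

(* Defs.v *)
From HB Require Import structures.
From mathcomp Require Import all_boot all_order all_algebra.
From mathcomp Require Import all_classical all_reals all_analysis.

Set Implicit Arguments.
Unset Strict Implicit.
Unset Printing Implicit Defensive.
Import Order.TTheory GRing.Theory Num.Theory.
Import numFieldNormedType.Exports.
Local Open Scope classical_set_scope.
Local Open Scope ring_scope.

Section ConvexAnalysis.
Context {R : realType} {n : nat}.
Local Notation V := 'rV[R]_n.
Implicit Types (x y u v : V) (f g phi : V -> \bar R) (h : V -> R).

Definition dot x y : R := \sum_(i < n) x ord0 i * y ord0 i.

                                                                           
                                                              
                        
Definition enorm x : R := Num.sqrt (dot x x).

                                                                            
                    
Definition dom f : set V := [set x | (f x < +oo)%E].

Definition proper_fun f : Prop := (forall x, f x != -oo%E) /\ dom f !=set0.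

Definition epigraph f : set (V * R^o) := [set z | (f z.1 <= z.2%:E)%E].

Definition ccp f : Prop :=
  [/\ closed (epigraph f), convex_set (epigraph f) & proper_fun f].

Definition conjugate g (y : V) : \bar R :=
  ereal_sup [set ((dot y x)%:E - g x)%E | x in [set: V]].

Definition subdiff f x : set V :=
  [set v | forall y, (f x + (dot v (y - x))%:E <= f y)%E].

Definition argmin phi : set V := [set y | forall z, (phi y <= phi z)%E].

                                                                             
                                            
Definition prox phi x : set V :=
  argmin (fun y => phi y + (2^-1 * enorm (y - x) ^+ 2)%:E)%E.

Definition grad h x : V := \row_i 'D_(delta_mx ord0 i) h x.

Definition smooth (L : R) h : Prop :=
  (forall x, differentiable h x) /\
  (forall x y, enorm (grad h x - grad h y) <= L * enorm (x - y)).

Definition lagrangian f g h x u : \bar R :=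
  if x \notin dom f then +oo%E
  else if u \notin dom (conjugate g) then -oo%E
  else (f x + (h x)%:E + (dot u x)%:E - conjugate g u)%E.

End ConvexAnalysis.

(* Main.v *)
Require Import Defs.
From HB Require Import structures.
From mathcomp Require Import all_boot all_order all_algebra.
From mathcomp Require Import all_classical all_reals all_analysis.
From mathcomp Require Import ring lra.

Set Implicit Arguments.
Unset Strict Implicit.
Unset Printing Implicit Defensive.
Import Order.TTheory GRing.Theory Num.Theory.
Import numFieldNormedType.Exports.
Local Open Scope classical_set_scope.
Local Open Scope ring_scope.

(** Why the identity holds.

   Write [w k = F k + U k], [G k] for the gradient of [h] at [X k],
   [v k = w k + G k] and [D k = X k - alpha (U k + G k)]. The
   definitions of [F] and [P] amount to
     [alpha v (k+1) = D k - D (k+1)]  and  [P k = X k - alpha v k].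
   Hence the quadratic part of step [k] completes to a difference of squares,
     [- <v k, D k + alpha/2 v k> = (|D k|^2 - |D (k-1)|^2) / (2 alpha)],
   and summing over [k] telescopes it into an expression in [D 0] and the sum
   of the [v k] ([step_identity], [sum_steps]). What the telescoping leaves
   behind is linear in the sums of [|w k|^2], of [|G k|^2] and of
   [<G k, X k>], and these three cancel against [I_h] and [S_2], because the
   pairwise squared distances of a family are determined by its sum and its
   sum of squared norms ([sum_pairwise_sqr_dist]). The rest involves only the
   starting point, the comparison point, the two extra gradients and the sums
   of [w] and [G], and is a polynomial identity that can be checked one
   coordinate at a time ([averaged_identity]). The result is [gap_identity].

   What remains concerns extended reals. The terms [f Xbar - f (X k)] and
   their analogues average out, and the values of [g] turn into values of its
   conjugate by the Fenchel equality [g p + g^* u = <u, p>] for [p] in the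
   subdifferential of [g^*] at [u]. As [p] is only given as a subgradient of
   the conjugate, this needs [u] to be a subgradient of [g] at [p]
   ([subdiff_of_conjugate]). Instead of the biconjugate theorem the proof
   decomposes [p + u = z + w] with [w] a subgradient of [g] at [z], by means
   of the proximal point [z] ([moreau_decomposition]): then [z] and [p] are
   subgradients of [g^*] at [w] and [u], and monotonicity together with
   [p - z = - (u - w)] forces [p = z]. The proximal point exists because a
   closed convex function decreases at most linearly ([convex_growth]) while
   the penalty grows quadratically, so that the minimum over a large compact
   ball is global ([prox_exists]). When [f x] is infinite, both sides are
   [-oo]. *)

(** * Inner products *)

Section InnerProduct.
Context {R : realType} {n : nat}.
Implicit Types (x y z : 'rV[R]_n).

Lemma dotC x y : dot x y = dot y x.
Proof. by apply: eq_bigr => i _; rewrite mulrC. Qed.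

Lemma dotDl x y z : dot (x + y) z = dot x z + dot y z.
Proof. by rewrite -big_split; apply: eq_bigr => i _; rewrite mxE mulrDl. Qed.

Lemma dotDr x y z : dot z (x + y) = dot z x + dot z y.
Proof. by rewrite dotC dotDl !(dotC z). Qed.

Lemma dotZl a x y : dot (a *: x) y = a * dot x y.
Proof. by rewrite mulr_sumr; apply: eq_bigr => i _; rewrite mxE mulrA. Qed.

Lemma dotZr a x y : dot x (a *: y) = a * dot x y.
Proof. by rewrite dotC dotZl dotC. Qed.

Lemma dotNl x y : dot (- x) y = - dot x y.
Proof. by rewrite -scaleN1r dotZl mulN1r. Qed.

Lemma dotNr x y : dot x (- y) = - dot x y.
Proof. by rewrite dotC dotNl dotC. Qed.

Lemma dot0l x : dot 0 x = 0.
Proof. by rewrite -(scale0r 0) dotZl mul0r. Qed.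

Lemma dot0r x : dot x 0 = 0.
Proof. by rewrite dotC dot0l. Qed.

Lemma dot_suml (s : seq nat) (X : nat -> 'rV[R]_n) y :
  dot (\sum_(k <- s) X k) y = \sum_(k <- s) dot (X k) y.
Proof. exact: (big_morph (dot^~ y) (fun a b => dotDl a b y) (dot0l y)). Qed.

Lemma dot_sumr (s : seq nat) (X : nat -> 'rV[R]_n) y :
  dot y (\sum_(k <- s) X k) = \sum_(k <- s) dot y (X k).
Proof. by rewrite dotC dot_suml; apply: eq_bigr => k _; rewrite dotC. Qed.

Lemma dotxx_ge0 x : 0 <= dot x x.
Proof. by apply: sumr_ge0 => i _; rewrite -expr2 sqr_ge0. Qed.

Lemma dotxx_eq0 x : dot x x <= 0 -> x = 0.
Proof.
move=> xx_le0; have xx0 : dot x x = 0 by apply/le_anti; rewrite xx_le0 dotxx_ge0.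
apply/rowP => i; rewrite mxE; apply/eqP; rewrite -sqrf_eq0 expr2; apply/eqP.
by apply: (psumr_eq0P _ xx0) => // j _; rewrite -expr2 sqr_ge0.
Qed.

Lemma sqr_enorm x : enorm x ^+ 2 = dot x x.
Proof. by rewrite sqr_sqrtr // dotxx_ge0. Qed.

Lemma sqr_enormBC x y : enorm (x - y) ^+ 2 = enorm (y - x) ^+ 2.
Proof. by rewrite -opprB !sqr_enorm dotNl dotNr opprK. Qed.

End InnerProduct.

(** Both sides of a polynomial identity between inner products are sums over
   the coordinates of the vectors, so it is enough to check it for numbers. *)
Ltac by_coordinates :=
  rewrite ?sqr_enorm /dot;
  do ?[rewrite mulr_sumr | rewrite -sumrN | rewrite -big_split /=];
  apply: eq_bigr => i _; rewrite !mxE.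

(** * Sums of squared distances *)

Section Algebra.
Context {R : realType} {n : nat}.
Implicit Types (x y z : 'rV[R]_n) (X : nat -> 'rV[R]_n).

Lemma sum_one K : \sum_(1 <= k < K.+1) (1 : R) = K%:R.
Proof. by rewrite sumr_const_nat subSS subn0. Qed.

Lemma sum_sqr_dist X K y :
  \sum_(1 <= k < K.+1) enorm (X k - y) ^+ 2 =
  \sum_(1 <= k < K.+1) dot (X k) (X k)
  - 2 * dot (\sum_(1 <= k < K.+1) X k) y + K%:R * dot y y.
Proof.
rewrite dot_suml mulr_sumr -sumrN -(sum_one K) mulr_suml -!big_split /=.
by apply: eq_bigr => k _; by_coordinates; ring.
Qed.

Lemma sum_pairwise_sqr_dist X K :
  \sum_(1 <= k < K.+1) \sum_(1 <= l < k) enorm (X k - X l) ^+ 2 =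
  K%:R * (\sum_(1 <= k < K.+1) dot (X k) (X k))
  - enorm (\sum_(1 <= k < K.+1) X k) ^+ 2.
Proof.
elim: K => [|K IHK]; first by rewrite !big_nil sqr_enorm dot0l mul0r subr0.
rewrite big_nat_recr //= IHK [in RHS]big_nat_recr //=.
rewrite [\sum_(1 <= k < K.+2) X k]big_nat_recr //=.
under [X in _ + X = _]eq_bigr do rewrite sqr_enormBC.
rewrite sum_sqr_dist !sqr_enorm !(dotDl, dotDr).
rewrite (dotC (X K.+1) (\sum_(1 <= k < K.+1) X k)) -natr1.
by ring.
Qed.

(** * The algebraic identity *)

(** With [D = X - a (U + G)] the current point, [D + a v] is the previous one;
   so [dot D D - dot (D + a *: v) (D + a *: v)] is the telescoping part of a
   step. *)
Lemma step_identity (a : R) (X U G F x u : 'rV[R]_n) :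
  a != 0 -> let v := F + U + G in let D := X - a *: (U + G) in
  dot F (x - X) + dot (u - U) (X - a *: v) =
  dot (F + U) x - dot U x + dot u X - a * dot u v
  + (2 * a)^-1 * (dot D D - dot (D + a *: v) (D + a *: v))
  + dot G X - a / 2 * dot G G + a / 2 * dot (F + U) (F + U).
Proof. by move=> a0 v D; rewrite /v /D; by_coordinates; field. Qed.

(** What is left of the identity once the sums over [k] have been carried
   out: [W] and [H] are the sums of the [F k + U k] and of the gradients. *)
Lemma averaged_identity (a k : R) (x0 u0 h0 x u hx hb W H : 'rV[R]_n) :
  a != 0 -> k != 0 -> k + 1 != 0 ->
  - (a * (k + 1))^-1 * (enorm (x0 - x) ^+ 2 + a ^+ 2 * enorm (u0 - u) ^+ 2) =
  k^-1 * dot W x - a / k * dot u (W + H)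
  - (2 * k)^-1 * dot (W + H) (2 *: (x0 - a *: (u0 + h0)) - a *: (W + H))
  + (a / 2 * dot hb hb - a / k * dot H hb)
  + (k - 1) / (k * (k + 1)) *
      (dot H x - a * dot H hx + k * (a / 2 * dot hx hx))
  + 2 / (k + 1) * (dot h0 (x - x0) + a / 2 * enorm (h0 - hx) ^+ 2)
  + 2 / (k * (k + 1)) * (dot H x0 - a * dot H h0 + k * (a / 2 * dot h0 h0))
  - (k + 1)^-1 *
      (a^-1 * enorm (x0 - x - (a * (k + 1) / (2 * k)) *: (W + H)
                     - a *: (h0 - k^-1 *: H)) ^+ 2
       + a * enorm (u0 - u + ((k + 1) / (2 * k)) *: (W + H)) ^+ 2
       + a * enorm (h0 - hx) ^+ 2)
  + a / (2 * k ^+ 2) * (enorm W ^+ 2 + enorm H ^+ 2)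
  - (a / 2 * enorm (hb - k^-1 *: H) ^+ 2
     + a * (k - 1) / (2 * (k + 1)) * enorm (hx - k^-1 *: H) ^+ 2).
Proof.
move=> a0 k0 k1; by_coordinates; field; by rewrite a0 k0 k1.
Qed.

Lemma sum_dev_mean X K y : (0 < K)%N ->
  \sum_(1 <= k < K.+1) dot y (X k - K%:R^-1 *: \sum_(1 <= k < K.+1) X k) = 0.
Proof.
move=> K_gt0; set Xbar := _ *: _.
rewrite -dot_sumr big_split /= sumr_const_nat subSS subn0 -[- Xbar *+ K]scaler_nat.
by rewrite scalerN scalerA mulfV ?pnatr_eq0 -?lt0n // scale1r subrr dot0r.
Qed.

Lemma sum_gap (a : R) X (G : nat -> 'rV[R]_n) (eta : nat -> R) K y ey gy :
  \sum_(1 <= k < K.+1) (eta k - ey + dot (G k) (y - X k)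
                        + a / 2 * enorm (G k - gy) ^+ 2) =
  \sum_(1 <= k < K.+1) eta k - K%:R * ey
  + dot (\sum_(1 <= k < K.+1) G k) y - \sum_(1 <= k < K.+1) dot (G k) (X k)
  + a / 2 * (\sum_(1 <= k < K.+1) dot (G k) (G k)
             - 2 * dot (\sum_(1 <= k < K.+1) G k) gy + K%:R * dot gy gy).
Proof.
rewrite !big_split /= -mulr_sumr sum_sqr_dist sumrN.
rewrite sumr_const_nat subSS subn0 -[ey *+ K]mulr_natl.
under [X in _ + X + _ = _]eq_bigr do rewrite dotDr dotNr.
by rewrite big_split /= -dot_suml sumrN !addrA.
Qed.

Lemma sum_gap_mean (a : R) X (G : nat -> 'rV[R]_n) (eta : nat -> R) K eb gb :
  (0 < K)%N -> let Xbar := K%:R^-1 *: \sum_(1 <= k < K.+1) X k in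
  \sum_(1 <= k < K.+1) (eb - eta k + dot gb (X k - Xbar)
                        + a / 2 * enorm (G k - gb) ^+ 2) =
  K%:R * eb - \sum_(1 <= k < K.+1) eta k
  + a / 2 * (\sum_(1 <= k < K.+1) dot (G k) (G k)
             - 2 * dot (\sum_(1 <= k < K.+1) G k) gb + K%:R * dot gb gb).
Proof.
move=> K_gt0 Xbar; rewrite !big_split /= -mulr_sumr sum_sqr_dist sumrN.
rewrite sumr_const_nat subSS subn0 -[eb *+ K]mulr_natl.
by rewrite sum_dev_mean // addr0.
Qed.

Section Iteration.
Variables (a : R) (X U G F P : nat -> 'rV[R]_n).
Hypothesis a_neq0 : a != 0.

Let D k := X k - a *: (U k + G k).
Let v k := F k + U k + G k.

Hypothesis FE : forall k, a *: v k.+1 = D k - D k.+1.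
Hypothesis PE : forall k, P k.+1 = X k.+1 - a *: v k.+1.

Lemma sum_v K : a *: (\sum_(1 <= k < K.+1) v k) = D 0%N - D K.
Proof.
elim: K => [|K IHK]; first by rewrite big_nil scaler0 subrr.
by rewrite big_nat_recr //= scalerDr IHK FE addrA subrK.
Qed.

Lemma sum_steps K x u :
  let W := \sum_(1 <= k < K.+1) (F k + U k) in
  let V := \sum_(1 <= k < K.+1) v k in
  \sum_(1 <= k < K.+1) dot (F k) (x - X k)
  + \sum_(1 <= k < K.+1) dot (u - U k) (P k) =
  dot W x - dot (\sum_(1 <= k < K.+1) U k) x
  + dot u (\sum_(1 <= k < K.+1) X k) - a * dot u V
  - 2^-1 * dot V (2 *: D 0%N - a *: V)
  + \sum_(1 <= k < K.+1) dot (G k) (X k)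
  - a / 2 * (\sum_(1 <= k < K.+1) dot (G k) (G k))
  + a / 2 * (\sum_(1 <= k < K.+1) dot (F k + U k) (F k + U k)).
Proof.
move=> W V.
(* D k.-1 is read only for k >= 1, so the truncation at 0 does not occur *)
have telescope : \sum_(1 <= k < K.+1)
    (dot (D k) (D k) - dot (D k.-1) (D k.-1)) =
    - a * dot V (2 *: D 0%N - a *: V).
  transitivity (dot (D K) (D K) - dot (D 0%N) (D 0%N)).
    by rewrite big_add1 telescope_sumr.
  have -> : D K = D 0%N - a *: V by rewrite sum_v subKr.
  by by_coordinates; ring.
have -> : 2^-1 * dot V (2 *: D 0%N - a *: V) =
    - (2 * a)^-1 * \sum_(1 <= k < K.+1) (dot (D k) (D k) - dot (D k.-1) (D k.-1)).
  by rewrite telescope; field.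
rewrite !(dot_suml, dot_sumr) !mulr_sumr -!sumrN -!big_split /=.
apply: eq_big_nat => -[|k] // _; rewrite PE step_identity //.
by rewrite -/(v k.+1) -/(D k.+1) FE (addrC (D k.+1)) subrK mulNr opprK.
Qed.

(** The values [eta k], [ex], [eb] and the vectors [G k], [gx], [gb] stand for
   the values and gradients of a smooth function along the iterates, at the
   comparison point and at the average. *)
Lemma gap_identity K (eta : nat -> R) ex eb (x u gx gb : 'rV[R]_n) :
  (0 < K)%N ->
  let Xbar := K%:R^-1 *: \sum_(1 <= k < K.+1) X k in
  let Ubar := K%:R^-1 *: \sum_(1 <= k < K.+1) U k in
  let Gbar := K%:R^-1 *: \sum_(1 <= k < K.+1) G k in
  let I_h : R :=
      K%:R^-1 *
        (\sum_(1 <= k < K.+1)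
           (eb - eta k + dot gb (X k - Xbar)
            + a / 2 * enorm (G k - gb) ^+ 2))
      + (K%:R - 1) / (K%:R * (K%:R + 1)) *
        (\sum_(1 <= k < K.+1)
           (eta k - ex + dot (G k) (x - X k)
            + a / 2 * enorm (G k - gx) ^+ 2))
      + 2 / (K%:R + 1) *
        (eta 0%N - ex + dot (G 0%N) (x - X 0%N)
         + a / 2 * enorm (G 0%N - gx) ^+ 2)
      + 2 / (K%:R * (K%:R + 1)) *
        (\sum_(1 <= k < K.+1)
           (eta k - eta 0%N + dot (G k) (X 0%N - X k)
            + a / 2 * enorm (G k - G 0%N) ^+ 2)) in
  let S_h : R :=
      a / 2 * enorm (gb - Gbar) ^+ 2
      + a * (K%:R - 1) / (2 * (K%:R + 1)) * enorm (gx - Gbar) ^+ 2 in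
  let S_1 : R :=
      (K%:R + 1)^-1 *
        (a^-1 * enorm (X 0%N - x
                  - (a * (K%:R + 1) / (2 * K%:R)) *:
                      (\sum_(1 <= k < K.+1) v k)
                  - a *: (G 0%N - Gbar)) ^+ 2
         + a * enorm (U 0%N - u
                  + ((K%:R + 1) / (2 * K%:R)) *:
                      (\sum_(1 <= k < K.+1) v k)) ^+ 2
         + a * enorm (G 0%N - gx) ^+ 2) in
  let S_2 : R :=
      a / (2 * K%:R ^+ 2) *
        (\sum_(1 <= k < K.+1) \sum_(1 <= l < k)
           (enorm (v k - G k - (v l - G l)) ^+ 2
            + enorm (G k - G l) ^+ 2)) in
  eb - ex + dot u Xbar - dot Ubar x
  - (a * (K%:R + 1))^-1
      * (enorm (X 0%N - x) ^+ 2 + a ^+ 2 * enorm (U 0%N - u) ^+ 2) =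
  K%:R^-1 * (\sum_(1 <= k < K.+1) dot (F k) (x - X k)
             + \sum_(1 <= k < K.+1) dot (u - U k) (P k))
  + I_h - S_1 - S_2 - S_h.
Proof.
move=> K_gt0 Xbar Ubar Gbar I_h S_h S_1 S_2.
have K0 : K%:R != 0 :> R by rewrite pnatr_eq0 -lt0n.
have K1 : K%:R + 1 != 0 :> R by rewrite natr1 pnatr_eq0.
pose W := \sum_(1 <= k < K.+1) (F k + U k).
pose GS := \sum_(1 <= k < K.+1) G k.
have VE : \sum_(1 <= k < K.+1) v k = W + GS by rewrite -big_split.
have S_2E : S_2 = a / (2 * K%:R ^+ 2) *
    (K%:R * (\sum_(1 <= k < K.+1) dot (F k + U k) (F k + U k)
             + \sum_(1 <= k < K.+1) dot (G k) (G k))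
     - enorm W ^+ 2 - enorm GS ^+ 2).
  rewrite /S_2; congr (_ * _).
  under eq_bigr => k _.
    rewrite big_split /=; under eq_bigr do rewrite /v !addrK; over.
  by rewrite big_split /= !sum_pairwise_sqr_dist -/W -/GS; ring.
rewrite S_2E /I_h sum_gap_mean // !sum_gap sum_steps VE -/W -/GS.
rewrite /S_h /S_1 VE -mulNr.
rewrite (averaged_identity _ _ (G 0%N) _ _ gx gb W GS) //.
rewrite /Xbar /Ubar /Gbar -/GS dotZl dotZr.
by field; rewrite K0 K1 a_neq0.
Qed.
End Iteration.
End Algebra.

(** * Existence of proximal points *)

Section LowerSemicontinuousMinimum.
Context {R : realType}.

(** The nonempty sublevel sets [{phi <= phi t}] are nested, hence a filter
   base; a cluster point lies in all of them. *)
Lemma compact_closed_sublevel_min (T : topologicalType) (A : set T)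
    (phi : T -> \bar R) :
  compact A -> A !=set0 ->
  (forall a, closed [set x | (phi x <= a)%E]) ->
  exists2 c, A c & forall t, A t -> (phi c <= phi t)%E.
Proof.
move=> A_compact [t0 At0] closed_sub.
pose B t := A `&` [set s | (phi s <= phi t)%E].
have B_filter : Filter (filter_from A B).
  apply: filter_from_filter; first by exists t0.
  move=> i j Ai Aj; have [ij|/ltW ji] := leP (phi i) (phi j).
    by exists i => // s [As si]; split; split => //; exact: le_trans si ij.
  by exists j => // s [As sj]; split; split => //; exact: le_trans sj ji.
have B_proper : ProperFilter (filter_from A B).
  by apply: filter_from_proper => t At; exists t; split => /=.
have [|c [Ac c_cluster]] := A_compact _ B_proper; first by exists t0 => // s [].
exists c => // t At; apply: closed_sub => N cN.
have [|s [[As st] Ns]] := c_cluster (B t) N _ cN; first by exists t.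
by exists s.
Qed.

Context {n : nat}.
Local Notation V := 'rV[R]_n.

Lemma continuous_sqr_dist (c : V) : continuous (fun z : V => dot (z - c) (z - c)).
Proof.
have coord i : continuous (fun z : V => (z - c) ord0 i).
  rewrite (_ : (fun z : V => _) = fun z : V => z ord0 i - c ord0 i).
    move=> z; apply: (@continuousB _ _ V (fun y : V => y ord0 i)).
      exact: coord_continuous.
    exact: cst_continuous.
  by apply/funext => z; rewrite !mxE.
move=> z; apply: (@cvg_big _ _ _ _ _ _ _ (nbhs (z : V))) => [|i _].
  exact: add_continuous.
by apply: (@continuousM _ V); exact: coord.
Qed.

Lemma closed_ball_compact_rV (c : V) (r : R) : compact [set x | `|x - c| <= r].
Proof.
apply: bounded_closed_compact.
  exists (r + `|c|); split; first exact: num_real.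
  move=> M ltM x /= xr; apply/ltW/(le_lt_trans _ ltM).
  by rewrite -[x in leLHS](subrK c) (le_trans (ler_normD _ _)) // lerD2r.
have -> : [set x | `|x - c| <= r] = closed_ball_ Num.norm c r.
  by apply/seteqP; split => x /=; rewrite distrC.
exact: closed_closed_ball_.
Qed.

(** The topology is that of the sup norm, which the Euclidean one dominates. *)
Lemma sqr_norm_le (x : V) : `|x| ^+ 2 <= dot x x.
Proof.
rewrite -sqr_enorm ler_sqr ?nnegrE ?sqrtr_ge0 //.
rewrite [leLHS]/Num.norm /= mx_normrE; apply: bigmax_le; first exact: sqrtr_ge0.
move=> [i j] _ /=; rewrite ord1 -sqrtr_sqr ler_sqrt ?dotxx_ge0 //.
rewrite /dot (bigD1 j) //= expr2 lerDl; apply: sumr_ge0 => l _.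
by rewrite -expr2 sqr_ge0.
Qed.

End LowerSemicontinuousMinimum.

Section Proper.
Context {R : realType} {n : nat}.
Local Notation V := 'rV[R]_n.
Implicit Types (f g phi : V -> \bar R).

Lemma proper_fin_num phi x : proper_fun phi -> dom phi x -> phi x \is a fin_num.
Proof. by case=> phiNy _ phi_x; rewrite fin_numE phiNy -ltey. Qed.

Lemma epigraph_convex phi (t : R) (x y : V) (a b : R) :
  convex_set (epigraph phi) -> 0 <= t -> t <= 1 ->
  (phi x <= a%:E)%E -> (phi y <= b%:E)%E ->
  (phi (t *: x + (1 - t) *: y)%R <= (t * a + (1 - t) * b)%:E)%E.
Proof.
move=> phi_convex t0 t1 xa yb.
have := phi_convex (x, a) (y, b) (Itv01 t0 t1).
by rewrite !inE; apply.
Qed.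

Lemma closed_sublevelD phi (q : V -> R) (a : \bar R) :
  closed (epigraph phi) -> (forall x, phi x != -oo%E) -> continuous q ->
  closed [set x | (phi x + (q x)%:E <= a)%E].
Proof.
move=> phi_closed phiNy q_cont; case: a => [a| |].
- have -> : [set x | (phi x + (q x)%:E <= a%:E)%E] =
      (fun x => (x, a - q x : R^o)) @^-1` epigraph phi.
    by apply/seteqP; split => x; rewrite /epigraph /= EFinB leeBrDr.
  apply: preimage_closed phi_closed => x _.
  apply: (@cvg_pair _ _ _ (nbhs (x : V)) (nbhs (x : V))
                          (nbhs (a - q x : R^o))).
    exact: cvg_id.
  apply: (@continuousB _ _ V (fun=> a)); last exact: q_cont.
  exact: cst_continuous.
- rewrite (_ : [set x | _] = setT); first exact: closedT.
  by apply/seteqP; split => x //= _; rewrite leey.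
- rewrite (_ : [set x | _] = set0); first exact: closed0.
  apply/seteqP; split => x //=.
  by rewrite leeNy_eq adde_eq_ninfty orbF (negbTE (phiNy x)).
Qed.

(** A convex function bounded below on the unit ball around [x0] decreases at
   most linearly away from [x0]: the point at distance 1 on the segment from
   [x0] to [x] lies in the ball. *)
Lemma convex_growth phi (x0 x : V) (m a0 b : R) :
  convex_set (epigraph phi) -> 1 <= `|x - x0| ->
  (forall y, `|y - x0| <= 1 -> (m%:E <= phi y)%E) ->
  (phi x0 <= a0%:E)%E -> (phi x <= b%:E)%E ->
  a0 - `|x - x0| * (a0 - m) <= b.
Proof.
move=> phi_convex; set t := `|x - x0| => t1 ball_min x0a xb.
have t0 : 0 < t by lra.
have tV0 : 0 <= t^-1 by rewrite invr_ge0 ltW.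
have tV1 : t^-1 <= 1 by rewrite invf_le1.
have := epigraph_convex phi_convex tV0 tV1 xb x0a.
have /ball_min my : `|t^-1 *: x + (1 - t^-1) *: x0 - x0| <= 1.
  rewrite scalerBl scale1r -addrA [x0 - _ - _]addrAC subrr add0r -scalerBr normrZ.
  by rewrite ger0_norm // mulVf // gt_eqF.
move=> /(le_trans my); rewrite lee_fin -(ler_pM2l t0) => m_le.
suff -> : b = t * (t^-1 * b + (1 - t^-1) * a0) - t * a0 + a0 by lra.
by field; rewrite gt_eqF.
Qed.

Lemma prox_exists f (c : V) : ccp f -> exists z, prox f c z.
Proof.
move=> [f_closed f_convex f_proper]; have [fNy [x0 x0_dom]] := f_proper.
pose pen x := 2^-1 * enorm (x - c) ^+ 2.
have pen_cont : continuous pen.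
  rewrite (_ : pen = fun x => 2^-1 * dot (x - c) (x - c)).
    move=> x; apply: (@continuousM _ V (fun=> 2^-1) (fun x => dot (x - c) (x - c))).
      exact: cst_continuous.
    exact: continuous_sqr_dist.
  by apply/funext => x; rewrite /pen sqr_enorm.
have ball_min r (q : V -> R) : 0 <= r -> continuous q ->
    exists2 z, `|z - x0| <= r &
    forall y, `|y - x0| <= r -> (f z + (q z)%:E <= f y + (q y)%:E)%E.
  move=> r0 q_cont; apply: compact_closed_sublevel_min.
  - exact: closed_ball_compact_rV.
  - by exists x0; rewrite /= subrr normr0.
  - by move=> a; exact: closed_sublevelD.
have f0E := fineK (proper_fin_num f_proper x0_dom).
set a0 := fine (f x0) in f0E.
have [z1 _ z1_min] : exists2 z, `|z - x0| <= 1 &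
    forall y, `|y - x0| <= 1 -> (f z <= f y)%E.
  have [z zr zmin] := ball_min 1 (fun=> 0) ler01 (@cst_continuous _ _ _).
  by exists z => // y /zmin; rewrite !adde0.
have f_z1 : (f z1 <= f x0)%E by apply: z1_min; rewrite subrr normr0.
have f1E := fineK (proper_fin_num f_proper (le_lt_trans f_z1 x0_dom)).
set m := fine (f z1) in f1E.
have m_le : m <= a0 by rewrite -lee_fin f0E f1E.
set s := `|x0 - c|; have s_ge0 : 0 <= s by exact: normr_ge0.
have pen0_ge0 : 0 <= pen x0 by rewrite mulr_ge0 // ?invr_ge0 // sqr_ge0.
(* beyond radius r half the squared distance to c, at least t^2/8,
   exceeds the linear loss t * (a0 - m) plus the penalty at x0 *)
pose r := 1 + 2 * s + 8 * (a0 - m) + 8 * pen x0.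
have r_ge0 : 0 <= r by rewrite /r; lra.
have [z _ z_min] := ball_min r pen r_ge0 pen_cont.
exists z => y; have [/z_min//|] := leP `|y - x0| r.
set t := `|y - x0| => rt.
apply: (@le_trans _ _ (f x0 + (pen x0)%:E)%E).
  by apply: z_min; rewrite subrr normr0.
have [fy|] := ltP (f y) +oo%E; last first.
  by rewrite leye_eq => /eqP ->; rewrite addye ?leey.
have fyE := fineK (proper_fin_num f_proper fy).
have growth : a0 - t * (a0 - m) <= fine (f y).
  apply: (@convex_growth f x0 y m a0) => //.
  - by move: rt; rewrite /r -/t; lra.
  - by move=> w wr; rewrite f1E z1_min.
  - by rewrite f0E.
  - by rewrite fyE.
have pen_y : 2^-1 * (t - s) ^+ 2 <= pen y.
  rewrite /pen ler_pM2l ?invr_gt0 // sqr_enorm (le_trans _ (sqr_norm_le _)) //.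
  have ts : t - s <= `|y - c|.
    rewrite lerBlDr /t -[y - x0](subrKA c).
    by rewrite (le_trans (ler_normD _ _)) // [`|c - x0|]distrC.
  rewrite ler_sqr ?nnegrE ?normr_ge0 //; move: rt; rewrite /r; lra.
rewrite -f0E -fyE -!EFinD lee_fin.
have A_ge0 : 0 <= a0 - m by rewrite subr_ge0.
have r_gt : 1 + 2 * s + 8 * (a0 - m) + 8 * pen x0 < t by [].
have t_gt1 : 1 < t by lra.
have t_sqr : t ^+ 2 <= 4 * (t - s) ^+ 2.
  have : 0 <= (2 * (t - s) - t) * (2 * (t - s) + t) by apply: mulr_ge0; lra.
  lra.
have t_big : t * (8 * (a0 - m) + 8 * pen x0) <= t ^+ 2.
  by rewrite expr2 ler_pM2l; lra.
have pen_t : pen x0 <= t * pen x0 by rewrite ler_peMl // ltW.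
rewrite -/(pen y); lra.
Qed.
End Proper.

(** * Subdifferentials of a function and of its conjugate *)

Section Subdifferentials.
Context {R : realType} {n : nat}.
Local Notation V := 'rV[R]_n.
Implicit Types (f g phi : V -> \bar R).

Lemma subdiff_fin_num phi x w :
  proper_fun phi -> subdiff phi x w -> phi x \is a fin_num.
Proof.
move=> phi_proper phi_sub; apply: proper_fin_num => //.
have [phiNy [y y_dom]] := phi_proper.
have := le_lt_trans (phi_sub y) y_dom; rewrite /dom /=.
by case: (phi x) => [r _|//|//]; rewrite ltry.
Qed.

(** Fermat's rule: compare the minimum with the points of the segment from [z]
   to [y], divide by the parameter and let it tend to 0. *)
Lemma prox_subdiff phi (c : R) (w z : V) :
  0 < c -> proper_fun phi -> convex_set (epigraph phi) ->
  prox (fun y => c%:E * phi y)%E w z -> subdiff phi z (c^-1 *: (w - z)).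
Proof.
move=> c_gt0 phi_proper phi_convex z_min y.
have [phiNy [y0 y0_dom]] := phi_proper.
have z_fin : phi z \is a fin_num.
  apply: proper_fin_num => //; have := z_min y0; rewrite /dom /=.
  rewrite -(fineK (proper_fin_num phi_proper y0_dom)).
  case: (phi z) (phiNy z) => [r _ _|_|//]; first by rewrite ltry.
  by rewrite gt0_muley // addye.
have [y_dom|] := ltP (phi y) +oo%E; last by rewrite leye_eq => /eqP ->; rewrite leey.
have phi_zE := fineK z_fin; have phi_yE := fineK (proper_fin_num phi_proper y_dom).
set a := fine (phi z) in phi_zE; set b := fine (phi y) in phi_yE.
pose d := dot (w - z) (y - z); pose q := dot (y - z) (y - z).
have segment t : 0 < t -> t <= 1 -> d <= c * (b - a) + t * q.
  move=> t_gt0 t_le1.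
  have : (phi (t *: y + (1 - t) *: z)%R <= (t * b + (1 - t) * a)%:E)%E.
    by apply: epigraph_convex; rewrite ?phi_zE ?phi_yE // ltW.
  have := z_min (t *: y + (1 - t) *: z); rewrite -phi_zE.
  have c_ge0 : (0 <= c%:E)%E by rewrite lee_fin ltW.
  move=> z_le /(lee_wpmul2l c_ge0) seg_le.
  have := le_trans z_le (leeD2r _ seg_le).
  rewrite -!EFinM -!EFinD lee_fin !sqr_enorm.
  have -> : t *: y + (1 - t) *: z - w = (z - w) + t *: (y - z).
    by rewrite scalerBl scale1r scalerBr addrC; apply/rowP => i; rewrite !mxE; ring.
  have -> : dot (z - w + t *: (y - z)) (z - w + t *: (y - z)) =
      dot (z - w) (z - w) - 2 * t * d + t ^+ 2 * q.
    by rewrite /d /q; by_coordinates; ring.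
  move=> le0; rewrite -(ler_pM2l t_gt0).
  have q_ge0 : 0 <= t ^+ 2 * q by rewrite mulr_ge0 ?sqr_ge0 ?dotxx_ge0.
  lra.
have d_le : d <= c * (b - a).
  apply/ler_addgt0Pl => e e_gt0; have q_ge0 : 0 <= q := dotxx_ge0 _.
  (* small enough for the quadratic error t * q to stay below e *)
  pose t := Num.min 1 (e / (q + 1)).
  have t_gt0 : 0 < t by rewrite lt_min ltr01 divr_gt0 // ltr_wpDl.
  have t_le1 : t <= 1 by rewrite ge_min lexx.
  apply: le_trans (segment t t_gt0 t_le1) _; rewrite addrC lerD2r.
  have t_le : t * (q + 1) <= e.
    by rewrite -ler_pdivlMr ?ltr_wpDl // ge_min lexx orbT.
  nra.
rewrite -phi_zE -phi_yE -EFinD lee_fin dotZl -/d.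
by rewrite -lerBrDl ler_pdivrMl.
Qed.

Lemma conjugate_ge g (y x : V) : ((dot y x)%:E - g x <= conjugate g y)%E.
Proof. by apply: ereal_sup_ubound; exists x. Qed.

Lemma subdiff_conjugateE g (z w : V) : proper_fun g -> subdiff g z w ->
  conjugate g w = ((dot w z)%:E - g z)%E.
Proof.
move=> g_proper gzw; apply/le_anti; rewrite conjugate_ge andbT.
have g_zE := fineK (subdiff_fin_num g_proper gzw).
apply: ge_ereal_sup => _ [x _ <-]; have := gzw x; rewrite -g_zE.
case: g_proper => /(_ x) gNy _; move: gNy.
case: (g x) => [b|_|//] _; last by rewrite addeNy leNye.
rewrite -EFinD -!EFinB !lee_fin dotDr dotNr; lra.
Qed.

Lemma subdiff_conjugate g (z w : V) : proper_fun g -> subdiff g z w ->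
  subdiff (conjugate g) w z.
Proof.
move=> g_proper gzw y; rewrite (subdiff_conjugateE g_proper gzw).
have g_zE := fineK (subdiff_fin_num g_proper gzw).
apply: le_trans (conjugate_ge g y z); rewrite -g_zE -!EFinB -EFinD lee_fin.
by rewrite dotDr dotNr (dotC z y) (dotC z w); lra.
Qed.

(** The proximal point of [c] provides the decomposition; it also shows that
   the conjugate is finite somewhere. *)
Lemma moreau_decomposition g (c : V) : ccp g ->
  exists2 z, subdiff g z (c - z) & subdiff (conjugate g) (c - z) z.
Proof.
move=> g_ccp; have [z z_prox] := prox_exists c g_ccp.
have [_ g_convex g_proper] := g_ccp.
have gz : subdiff g z (c - z).
  rewrite -[c - z]scale1r -[X in X *: _]invr1; apply: prox_subdiff => //.
  by rewrite (_ : (fun _ => _) = g) //; apply/funext => y; rewrite mul1e.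
by exists z => //; exact: subdiff_conjugate.
Qed.

Lemma conjugate_proper g : ccp g -> proper_fun (conjugate g).
Proof.
move=> g_ccp; have [_ _ g_proper] := g_ccp; split=> [y|].
  have [gNy [x x_dom]] := g_proper.
  have := conjugate_ge g y x; rewrite -(fineK (proper_fin_num g_proper x_dom)).
  by case: (conjugate g y).
have [z gz _] := moreau_decomposition 0 g_ccp.
exists (0 - z); rewrite /dom /= (subdiff_conjugateE g_proper gz).
by rewrite -(fineK (subdiff_fin_num g_proper gz)) -EFinB ltry.
Qed.

Lemma conjugate_convex g : proper_fun g -> convex_set (epigraph (conjugate g)).
Proof.
move=> [gNy _] [y a] [w b] t; rewrite !inE /epigraph /= => ya wb.
apply: ge_ereal_sup => _ [x _ <-]; have t0 : 0 <= t%:num :> R by apply: ge0.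
have t1 : t%:num <= 1 :> R by apply: le1.
have := le_trans (conjugate_ge g y x) ya.
have := le_trans (conjugate_ge g w x) wb.
case: (g x) (gNy x) => [r _|_ _ _|//]; last by rewrite addeNy leNye.
rewrite -!EFinB !lee_fin => wx yx.
rewrite dotDl !dotZl /unstable.onem.
have -> : t%:num * dot y x + (1 - t%:num) * dot w x - r =
    t%:num * (dot y x - r) + (1 - t%:num) * (dot w x - r) by ring.
by apply: lerD; apply: ler_wpM2l; rewrite ?subr_ge0.
Qed.

(** Decompose [p + u = z + w]. Monotonicity of the subdifferential of the
   conjugate gives [0 <= dot (p - z) (u - w) = - dot (p - z) (p - z)]. *)
Lemma subdiff_of_conjugate g (p u : V) : ccp g ->
  subdiff (conjugate g) u p -> subdiff g p u.
Proof.
move=> g_ccp up; have gc_proper := conjugate_proper g_ccp.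
have [z gz zc] := moreau_decomposition (p + u) g_ccp.
suff pz : p = z by move: gz; rewrite -pz [p + u]addrC addrK.
have := up (p + u - z); have := zc u.
rewrite -(fineK (subdiff_fin_num gc_proper up)).
rewrite -(fineK (subdiff_fin_num gc_proper zc)).
rewrite -!EFinD !lee_fin => zu pw.
apply/eqP; rewrite -subr_eq0; apply/eqP/dotxx_eq0.
have -> : dot (p - z) (p - z) =
    dot p (p + u - z - u) + dot z (u - (p + u - z)).
  by by_coordinates; ring.
lra.
Qed.
End Subdifferentials.

(** * Averages of function values and the Lagrangian *)

Section SaddleGap.
Context {R : realType} {n : nat}.
Local Notation V := 'rV[R]_n.
Implicit Types (f g : V -> \bar R) (X U P F : nat -> V).

Lemma EFin_sum (K : nat) (a : nat -> \bar R) (b : nat -> R) :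
  (forall k, (1 <= k)%N -> a k = (b k)%:E) ->
  (\sum_(1 <= k < K.+1) a k = (\sum_(1 <= k < K.+1) b k)%:E)%E.
Proof. by move=> ab; rewrite -sumEFin; apply: eq_big_nat => k /andP[/ab]. Qed.

Lemma EFin_two_sums (c : R) (K : nat) (a a' : nat -> \bar R) (b b' : nat -> R) :
  (forall k, (1 <= k)%N -> a k = (b k)%:E) ->
  (forall k, (1 <= k)%N -> a' k = (b' k)%:E) ->
  (c%:E * (\sum_(1 <= k < K.+1) a k) + c%:E * (\sum_(1 <= k < K.+1) a' k) =
   (c * (\sum_(1 <= k < K.+1) b k) + c * (\sum_(1 <= k < K.+1) b' k))%:E)%E.
Proof. by move=> ab ab'; rewrite (EFin_sum _ ab) (EFin_sum _ ab'). Qed.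

(** The linear terms at the average vanish, as the deviations from a mean sum
   to 0, and the values [phi k] cancel. *)
Lemma mean_f_terms X F (phi : nat -> R) K fb fx (Fbar x : V) : (0 < K)%N ->
  let Xbar := K%:R^-1 *: \sum_(1 <= k < K.+1) X k in
  K%:R^-1 * (\sum_(1 <= k < K.+1) (fb - phi k + dot Fbar (X k - Xbar)))
  + K%:R^-1 * (\sum_(1 <= k < K.+1) (phi k - fx + dot (F k) (x - X k))) =
  fb - fx + K%:R^-1 * \sum_(1 <= k < K.+1) dot (F k) (x - X k).
Proof.
move=> K_gt0 Xbar; have K0 : K%:R != 0 :> R by rewrite pnatr_eq0 -lt0n.
have [Kf Kx] : \sum_(1 <= k < K.+1) fb = K%:R * fb /\
    \sum_(1 <= k < K.+1) fx = K%:R * fx.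
  by rewrite !sumr_const_nat subSS subn0 !mulr_natl.
rewrite !big_split /= !sumrN sum_dev_mean // Kf Kx.
by field.
Qed.

Lemma mean_g_terms U P (psi : nat -> R) K gp gb (Pbar p u : V) : (0 < K)%N ->
  let Ubar := K%:R^-1 *: \sum_(1 <= k < K.+1) U k in
  K%:R^-1 * (\sum_(1 <= k < K.+1) (psi k - gb + dot (U k) (Pbar - P k)))
  + K%:R^-1 * (\sum_(1 <= k < K.+1) (gp - psi k + dot u (P k - p))) =
  (dot Ubar Pbar - gb) - (dot u p - gp)
  + K%:R^-1 * \sum_(1 <= k < K.+1) dot (u - U k) (P k).
Proof.
move=> K_gt0 Ubar; have K0 : K%:R != 0 :> R by rewrite pnatr_eq0 -lt0n.
have [Kp [Kb Kup]] : \sum_(1 <= k < K.+1) gp = K%:R * gp /\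
    \sum_(1 <= k < K.+1) gb = K%:R * gb /\
    \sum_(1 <= k < K.+1) dot u p = K%:R * dot u p.
  by rewrite !sumr_const_nat subSS subn0 !mulr_natl.
under [in LHS]eq_bigr do rewrite dotDr dotNr.
under [X in _ + _ * X]eq_bigr do rewrite dotDr dotNr.
under [in RHS]eq_bigr do rewrite dotDl dotNl.
rewrite /Ubar dotZl dot_suml !big_split /= !sumrN Kp Kb Kup.
by field.
Qed.

Lemma lagrangian_fin f g (h : V -> R) (x u : V) (a b : R) :
  f x = a%:E -> conjugate g u = b%:E ->
  lagrangian f g h x u = (a + h x + dot u x - b)%:E.
Proof.
move=> fx gu; have x_dom : dom f x by rewrite /dom /= fx ltry.
have u_dom : dom (conjugate g) u by rewrite /dom /= gu ltry.
by rewrite /lagrangian (mem_set x_dom) (mem_set u_dom) /= fx gu.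
Qed.

End SaddleGap.

Theorem proposition4p4 (R : realType) (n : nat)
  (f g : 'rV[R]_n -> \bar R) (h : 'rV[R]_n -> R) (L alpha : R)
  (f_ccp : ccp f) (g_ccp : ccp g)
  (h_convex : convex_function [set: 'rV[R]_n] h)
  (L_gt0 : 0 < L) (h_smooth : smooth L h)
  (saddle : exists xs us : 'rV[R]_n,
     [set s + grad h xs + us | s in subdiff f xs] 0 /\
     [set q - xs | q in subdiff (conjugate g) us] 0)
  (alphaE : alpha = L^-1)
  (X U : nat -> 'rV[R]_n)
  (X_iter : forall k : nat,
     prox (fun z => alpha%:E * f z)%E
          (X k - alpha *: (U k + grad h (X k)))
          (X k.+1))
  (U_iter : forall k : nat,
     prox (fun z => (alpha^-1)%:E * conjugate g z)%E
          (U k + alpha^-1 *: (2 *: X k.+1 - X k + alpha *: grad h (X k)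
                              - alpha *: grad h (X k.+1)))
          (U k.+1))
  (K : nat) (K_ge1 : (1 <= K)%N) :
  let P (k : nat) : 'rV[R]_n :=
    X k + (X k - X k.-1)
    + alpha *: ((grad h (X k.-1) + U k.-1) - (grad h (X k) + U k)) in
  let F (k : nat) : 'rV[R]_n :=
    alpha^-1 *: (X k.-1 - alpha *: (U k.-1 + grad h (X k.-1)) - X k) in
  let v (k : nat) : 'rV[R]_n := F k + U k + grad h (X k) in
  let Xbar : 'rV[R]_n := K%:R^-1 *: \sum_(1 <= k < K.+1) X k in
  let Ubar : 'rV[R]_n := K%:R^-1 *: \sum_(1 <= k < K.+1) U k in
  let Hbar : 'rV[R]_n := K%:R^-1 *: \sum_(1 <= k < K.+1) grad h (X k) in
  (forall k : nat, (1 <= k)%N -> subdiff (conjugate g) (U k) (P k)) /\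
  (forall k : nat, (1 <= k)%N -> subdiff f (X k) (F k)) /\
  forall x u Pbar p Fbar : 'rV[R]_n,
    subdiff (conjugate g) Ubar Pbar ->
    subdiff (conjugate g) u p ->
    subdiff f Xbar Fbar ->
    let I_f : \bar R :=
      ((K%:R^-1)%:E *
         (\sum_(1 <= k < K.+1)
            (f Xbar - f (X k) + (dot Fbar (X k - Xbar))%:E))
       + (K%:R^-1)%:E *
         (\sum_(1 <= k < K.+1)
            (f (X k) - f x + (dot (F k) (x - X k))%:E)))%E in
    let I_g : \bar R :=
      ((K%:R^-1)%:E *
         (\sum_(1 <= k < K.+1)
            (g (P k) - g Pbar + (dot (U k) (Pbar - P k))%:E))
       + (K%:R^-1)%:E *
         (\sum_(1 <= k < K.+1)
            (g p - g (P k) + (dot u (P k - p))%:E)))%E in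
    let I_h : R :=
      K%:R^-1 *
        (\sum_(1 <= k < K.+1)
           (h Xbar - h (X k) + dot (grad h Xbar) (X k - Xbar)
            + alpha / 2 * enorm (grad h (X k) - grad h Xbar) ^+ 2))
      + (K%:R - 1) / (K%:R * (K%:R + 1)) *
        (\sum_(1 <= k < K.+1)
           (h (X k) - h x + dot (grad h (X k)) (x - X k)
            + alpha / 2 * enorm (grad h (X k) - grad h x) ^+ 2))
      + 2 / (K%:R + 1) *
        (h (X 0%N) - h x + dot (grad h (X 0%N)) (x - X 0%N)
         + alpha / 2 * enorm (grad h (X 0%N) - grad h x) ^+ 2)
      + 2 / (K%:R * (K%:R + 1)) *
        (\sum_(1 <= k < K.+1)
           (h (X k) - h (X 0%N) + dot (grad h (X k)) (X 0%N - X k)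
            + alpha / 2 * enorm (grad h (X k) - grad h (X 0%N)) ^+ 2)) in
    let S_h : R :=
      alpha / 2 * enorm (grad h Xbar - Hbar) ^+ 2
      + alpha * (K%:R - 1) / (2 * (K%:R + 1))
        * enorm (grad h x - Hbar) ^+ 2 in
    let S_1 : R :=
      (K%:R + 1)^-1 *
        (alpha^-1 *
           enorm (X 0%N - x
                  - (alpha * (K%:R + 1) / (2 * K%:R)) *:
                      (\sum_(1 <= k < K.+1) v k)
                  - alpha *: (grad h (X 0%N) - Hbar)) ^+ 2
         + alpha *
           enorm (U 0%N - u
                  + ((K%:R + 1) / (2 * K%:R)) *:
                      (\sum_(1 <= k < K.+1) (F k + U k + grad h (X k)))) ^+ 2
         + alpha * enorm (grad h (X 0%N) - grad h x) ^+ 2) in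
    let S_2 : R :=
      alpha / (2 * K%:R ^+ 2) *
        (\sum_(1 <= k < K.+1) \sum_(1 <= l < k)
           (enorm (v k - grad h (X k) - (v l - grad h (X l))) ^+ 2
            + enorm (grad h (X k) - grad h (X l)) ^+ 2)) in
    (lagrangian f g h Xbar u - lagrangian f g h x Ubar
       - ((alpha * (K%:R + 1))^-1
          * (enorm (X 0%N - x) ^+ 2 + alpha ^+ 2 * enorm (U 0%N - u) ^+ 2))%:E
     = I_f + I_g + I_h%:E - S_1%:E - S_2%:E - S_h%:E)%E.
Proof.
have a_gt0 : 0 < alpha by rewrite alphaE invr_gt0.
have a_neq0 : alpha != 0 by rewrite gt_eqF.
have [_ f_convex f_proper] := f_ccp; have [_ _ g_proper] := g_ccp.
have gc_proper := conjugate_proper g_ccp.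
move=> P F v Xbar Ubar Hbar.
have P_sub k : (1 <= k)%N -> subdiff (conjugate g) (U k) (P k).
  case: k => // k _.
  have := prox_subdiff _ gc_proper (conjugate_convex g_proper) (U_iter k).
  rewrite invr_gt0 => /(_ a_gt0); congr (subdiff _ _).
  by apply/rowP => i; rewrite /P !mxE; field.
have F_sub k : (1 <= k)%N -> subdiff f (X k) (F k).
  by case: k => // k _; exact: prox_subdiff (X_iter k).
split=> //; split=> // x u Pbar p Fbar Pbar_sub p_sub Fbar_sub.
have fin_f y s : subdiff f y s -> f y = (fine (f y))%:E.
  by move=> ys; rewrite fineK // (subdiff_fin_num f_proper ys).
have fin_g w q : subdiff (conjugate g) w q -> g q = (fine (g q))%:E.
  move=> /(subdiff_of_conjugate g_ccp) qw.
  by rewrite fineK // (subdiff_fin_num g_proper qw).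
have conj_E w q : subdiff (conjugate g) w q ->
    conjugate g w = (dot w q - fine (g q))%:E.
  move=> wq; have qw := subdiff_of_conjugate g_ccp wq.
  by rewrite (subdiff_conjugateE g_proper qw) (fin_g _ _ wq).
move=> I_f I_g I_h S_h S_1 S_2.
pose phi k := fine (f (X k)); pose psi k := fine (g (P k)).
pose fb := fine (f Xbar).
have fbE : f Xbar = fb%:E := fin_f _ _ Fbar_sub.
have sum1E : (\sum_(1 <= k < K.+1)
      (f Xbar - f (X k) + (dot Fbar (X k - Xbar))%:E) =
    (\sum_(1 <= k < K.+1) (fb - phi k + dot Fbar (X k - Xbar)))%:E)%E.
  by apply: EFin_sum => k k1; rewrite fbE (fin_f _ _ (F_sub k k1)).
have I_gE : I_g = (K%:R^-1 *
      (\sum_(1 <= k < K.+1) (psi k - fine (g Pbar) + dot (U k) (Pbar - P k)))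
    + K%:R^-1 *
      (\sum_(1 <= k < K.+1) (fine (g p) - psi k + dot u (P k - p))))%:E.
  apply: EFin_two_sums => k k1;
    by rewrite (fin_g _ _ (P_sub k k1)) 1?(fin_g _ _ p_sub) 1?(fin_g _ _ Pbar_sub).
have lag_bar := lagrangian_fin h fbE (conj_E _ _ p_sub).
(* if f x = +oo, each term f (X k) - f x of I_f is -oo, and so is the
   left-hand side, where the Lagrangian at x is subtracted *)
have [fx_lt|fx_ge] := ltP (f x) +oo%E; last first.
  have fx : f x = +oo%E by apply/eqP; rewrite -leye_eq.
  have -> : lagrangian f g h x Ubar = +oo%E.
    by rewrite /lagrangian memNset // /dom /= fx.
  have -> : I_f = -oo%E.
    rewrite /I_f sum1E -EFinM [X in (_ * X)%E](_ : _ = -oo%E).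
      by rewrite gt0_muleNy ?addeNy // lte_fin invr_gt0 ltr0n.
    by rewrite big_nat_recr //= (fin_f _ _ (F_sub K K_ge1)) fx /= addNye addeNy.
  by rewrite lag_bar /= !addNye.
have fxE := esym (fineK (proper_fin_num f_proper fx_lt)).
rewrite lag_bar (lagrangian_fin h fxE (conj_E _ _ Pbar_sub)) I_gE.
have -> : I_f = (K%:R^-1 *
      (\sum_(1 <= k < K.+1) (fb - phi k + dot Fbar (X k - Xbar)))
    + K%:R^-1 *
      (\sum_(1 <= k < K.+1) (phi k - fine (f x) + dot (F k) (x - X k))))%:E.
  apply: EFin_two_sums => k k1; first by rewrite fbE (fin_f _ _ (F_sub k k1)).
  by rewrite fxE (fin_f _ _ (F_sub k k1)).
rewrite -!EFinB mean_f_terms // mean_g_terms //; congr EFin.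
have FE k : alpha *: v k.+1 = (X k - alpha *: (U k + grad h (X k)))
    - (X k.+1 - alpha *: (U k.+1 + grad h (X k.+1))).
  by apply/rowP => i; rewrite /v /F !mxE; field.
have PE k : P k.+1 = X k.+1 - alpha *: v k.+1.
  by apply/rowP => i; rewrite /v /P /F !mxE; field.
have := gap_identity a_neq0 FE PE (fun k => h (X k)) (h x) (h Xbar) x u
  (grad h x) (grad h Xbar) K_ge1.
rewrite /= -/Xbar -/Ubar -/Hbar -/I_h -/S_h -/S_1 -/S_2 mulrDr => gapE.
lra.
Qed.
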